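(* Let $\mathscr{A}$ be a (not necessarily unital) complex $^*$-algebra and let $v,w$ be representable functionals on it. The following assertions are equivalent: (i) $w$ is $v$-absolutely continuous; (ii) there exists a positive selfadjoint (not necessarily bounded) operator $W$ on $\mathfrak{H}_v$ such that $\{\pi_v(a)\zeta_v:a\in\mathscr{A}\}\subseteq\operatorname{dom}W$ and $$w(b^*a)=(W\pi_v(a)\zeta_v\,|\,W\pi_v(b)\zeta_v)_v,\qquad a,b\in\mathscr{A};$$ furthermore, $\pi_v(a)\xi\in\operatorname{dom}W$ for all $a\in\mathscr{A}$ and $\xi\in\operatorname{dom}W$, and $$(W\pi_v(a)\xi\,|\,W\eta)_v=(W\xi\,|\,W\pi_v(a^* )\eta)_v,\qquad a\in\mathscr{A},\ \xi,\eta\in\operatorname{dom}W.$$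
   Context: A positive functional $v$ on $\mathscr{A}$ (a linear functional with $v(a^*a)\ge0$ for all $a$) is representable if there exist a Hilbert space $\mathfrak{H}_v$ with inner product $(\cdot\,|\,\cdot)_v$, a $^*$-representation $\pi_v$ of $\mathscr{A}$ into $\mathscr{B}(\mathfrak{H}_v)$ and a vector $\zeta_v\in\mathfrak{H}_v$ that is cyclic (i.e. $\{\pi_v(a)\zeta_v:a\in\mathscr{A}\}$ is dense in $\mathfrak{H}_v$) such that $v(a)=(\pi_v(a)\zeta_v\,|\,\zeta_v)_v$ for all $a\in\mathscr{A}$. Such a triple $(\mathfrak{H}_v,\pi_v,\zeta_v)$ (obtained by the GNS construction) is fixed for $v$. $w$ is absolutely continuous with respect to $v$ ($v$-absolutely continuous) if for every sequence $(a_n)$ in $\mathscr{A}$, $v(a_n^*a_n)\to0$ and $w((a_n^*-a_m^* )(a_n-a_m))\to0$ (as $n,m\to\infty$) imply $w(a_n^*a_n)\to0$. *)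

(* Defs.v *)
From HB Require Import structures.
From mathcomp Require Import all_boot all_order all_algebra.
From mathcomp Require Import sesquilinear complex.
From mathcomp Require Import all_classical all_reals all_analysis.

Set Implicit Arguments.
Unset Strict Implicit.
Unset Printing Implicit Defensive.

Import Order.TTheory GRing.Theory Num.Theory.
Import numFieldNormedType.Exports.

Local Open Scope classical_set_scope.
Local Open Scope ring_scope.
Local Open Scope complex_scope.

(* MathComp rings are unital, so a possibly non-unital *-algebra is built
   directly on top of a complex vector space. *)
HB.mixin Record Lmodule_isStarAlgebra (R : realType) A
    of GRing.Lmodule R[i] A := {
  smul : {bilinear A -> A -> A};
  star : A -> A;
  smulA : forall a b c : A, smul a (smul b c) = smul (smul a b) c;
  star_semilinear : forall (k : R[i]) (a b : A),
    star (k *: a + b) = Num.conj k *: star a + star b;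
  starK : forall a : A, star (star a) = a;
  starM : forall a b : A, star (smul a b) = smul (star b) (star a) }.

#[short(type="starAlgType")]
HB.structure Definition StarAlgebra (R : realType) :=
  { A of GRing.Lmodule R[i] A & Lmodule_isStarAlgebra R A }.

Notation "a ** b" := (smul a b) (at level 40, left associativity) : ring_scope.

(* [{dot H for Num.conj}] is linear in the first argument and
   conjugate-linear in the second one. *)
HB.mixin Record CompleteNormedModule_isHilbert (R : realType) H
    of CompleteNormedModule R[i] H := {
  inner : {dot H for Num.conj};
  inner_norm : forall x : H, inner x x = `|x| ^+ 2 }.

#[short(type="hilbertType")]
HB.structure Definition Hilbert (R : realType) :=
  { H of CompleteNormedModule R[i] H & CompleteNormedModule_isHilbert R H }.

Section StarAlgebras.
Context {R : realType} {A : starAlgType R}.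

(* In [R[i]], [0 <= z] means that [z] is real and nonnegative. *)
Definition positive_functional (v : {scalar A}) : Prop :=
  forall a : A, 0 <= v (star a ** a).

Definition bounded_operator (H : hilbertType R) (f : H -> H) : Prop :=
  linear f /\ exists M : R, forall x : H, `|f x| <= M%:C * `|x|.

Definition star_representation (H : hilbertType R) (pi : A -> H -> H) : Prop :=
  [/\ forall a, bounded_operator (pi a),
      forall (k : R[i]) a b x, pi (k *: a + b) x = k *: pi a x + pi b x,
      forall a b x, pi (a ** b) x = pi a (pi b x) &
      forall a x y, inner (pi a x) y = inner x (pi (star a) y) ].

Definition gns_triple (v : {scalar A})
    (H : hilbertType R) (pi : A -> H -> H) (zeta : H) : Prop :=
  [/\ star_representation pi,
      dense (range (fun a => pi a zeta)) &
      forall a, v a = inner (pi a zeta) zeta ].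

Definition representable (v : {scalar A}) : Prop :=
  positive_functional v /\
  exists (H : hilbertType R) (pi : A -> H -> H) (zeta : H),
    gns_triple v pi zeta.

Definition absolutely_continuous (w v : {scalar A}) : Prop :=
  forall a : nat -> A,
    v (star (a n) ** a n) @[n --> \oo] --> (0 : R[i]^o) ->
    w ((star (a nm.1) - star (a nm.2)) ** (a nm.1 - a nm.2)) @[nm --> (\oo, \oo)]
      --> (0 : R[i]^o) ->
    w (star (a n) ** a n) @[n --> \oo] --> (0 : R[i]^o).

End StarAlgebras.

(* The values of [op_fun] outside of [op_dom] are irrelevant. *)
Record operator (R : realType) (H : hilbertType R) := Operator {
  op_dom : set H;
  op_fun :> H -> H;
  op_dom0 : op_dom 0;
  op_domP : forall (k : R[i]) x y,
    op_dom x -> op_dom y -> op_dom (k *: x + y);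
  op_linear : forall (k : R[i]) x y,
    op_dom x -> op_dom y -> op_fun (k *: x + y) = k *: op_fun x + op_fun y }.

Section Operators.
Context {R : realType} {H : hilbertType R}.
Implicit Type W : operator H.

(* The graph of the adjoint of [W] ; it is functional when [W] is densely
   defined. *)
Definition adjoint_graph W (y z : H) : Prop :=
  forall x, op_dom W x -> inner (W x) y = inner x z.

Definition selfadjoint W : Prop :=
  dense (op_dom W) /\
  forall y z, adjoint_graph W y z <-> op_dom W y /\ W y = z.

Definition positive_operator W : Prop :=
  forall x, op_dom W x -> 0 <= inner (W x) x.

End Operators.

(* Main.v *)
(* Let T be the map pi_v(a) zeta_v |-> pi_w(a) zeta_w; absolute continuity says
   exactly that T is closable, and W is the modulus |T| of its closure.  With
   B = (1 + T^*T)^-1, obtained by projecting (z, 0) onto the graph of T, and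
   C = B^(1/2), D = (1 - B)^(1/2), the modulus is W = D C^-1, with domain
   ran C = dom T.  Square roots of 1 - A for a symmetric contraction A come from
   the iteration X_{n+1} = (A + X_n^2) / 2, whose increments are dominated by
   those of the scalar iteration r_{n+1} = (1 + r_n^2) / 2.  Conversely, if W
   exists, closability of T follows from the symmetry of W and the density of
   its domain. *)
Require Import Defs.
From mathcomp Require Import all_boot all_order all_algebra.
From mathcomp Require Import sesquilinear complex.
From mathcomp Require Import all_classical all_reals all_analysis.
From mathcomp Require Import ring lra.

Set Implicit Arguments.
Unset Strict Implicit.
Unset Printing Implicit Defensive.

Import Order.TTheory GRing.Theory Num.Theory.
Import numFieldNormedType.Exports.

Local Open Scope classical_set_scope.
Local Open Scope ring_scope.
Local Open Scope complex_scope.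

(** * Real part of the inner product and real-valued norm *)

Section Norm.
Context {R : realType} {H : hilbertType R}.
Implicit Types (x y z : H) (k : R[i]) (c : R).

(* The order of [R[i]] is partial, so estimates are made in [R]. *)
Definition rip x y : R := complex.Re (inner x y).
Definition nm x : R := complex.Re `|x|.

Lemma normE x : `|x| = (nm x)%:C.
Proof. by rewrite /nm (RRe_real (normr_real x)). Qed.

Lemma nm_ge0 x : 0 <= nm x.
Proof. by rewrite -ler0c -normE. Qed.

Lemma nm0 : nm 0 = 0. Proof. by rewrite /nm normr0. Qed.

Lemma nmB x y : nm (x - y) = nm (y - x). Proof. by rewrite /nm distrC. Qed.

Lemma nmD x y : nm (x + y) <= nm x + nm y.
Proof. by rewrite -lecR rmorphD/= -!normE ler_normD. Qed.

Lemma nm_eq0 x : nm x = 0 -> x = 0.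
Proof. by move=> x0; apply/eqP; rewrite -normr_eq0 normE x0. Qed.

Lemma nmZ k x : nm (k *: x) = complex.Re `|k| * nm x.
Proof.
apply: (@complexI R).
by rewrite -normE rmorphM/= -normE normrZ (RRe_real (normr_real k)).
Qed.

Lemma nmZr c x : 0 <= c -> nm (c%:C *: x) = c * nm x.
Proof. by move=> c0; rewrite nmZ ger0_norm// ler0c. Qed.

Lemma innerC x y : inner x y = conjc (inner y x).
Proof. by rewrite (hermC inner)/= expr0 mul1r. Qed.

Lemma innerDl x y z : inner (x + y) z = inner x z + inner y z.
Proof. exact: linearDl. Qed.

Lemma innerZl k x y : inner (k *: x) y = k * inner x y.
Proof. exact: linearZl_LR. Qed.

Lemma innerZr k x y : inner x (k *: y) = conjc k * inner x y.
Proof. exact: linearZr_LR. Qed.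

Lemma ripC x y : rip x y = rip y x.
Proof. by rewrite /rip innerC; case: (inner y x). Qed.

Lemma ripDl x y z : rip (x + y) z = rip x z + rip y z.
Proof. by rewrite /rip innerDl; case: (inner x z) (inner y z) => [? ?] []. Qed.

Lemma ripDr x y z : rip z (x + y) = rip z x + rip z y.
Proof. by rewrite ripC ripDl !(ripC z). Qed.

Lemma ripZl c x y : rip (c%:C *: x) y = c * rip x y.
Proof. by rewrite /rip innerZl; case: (inner x y) => a b/=; ring. Qed.

Lemma ripZr c x y : rip x (c%:C *: y) = c * rip x y.
Proof. by rewrite ripC ripZl ripC. Qed.

Lemma ripZC k x y : rip (k *: x) y = rip x (conjc k *: y).
Proof. by rewrite /rip innerZl innerZr conjcK. Qed.

Lemma ripNl x y : rip (- x) y = - rip x y.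
Proof.
by rewrite (_ : - x = (-1 : R)%:C *: x) ?ripZl ?mulN1r// rmorphN1 scaleN1r.
Qed.

Lemma ripNr x y : rip x (- y) = - rip x y.
Proof. by rewrite ripC ripNl ripC. Qed.

Lemma ripBl x y z : rip (x - y) z = rip x z - rip y z.
Proof. by rewrite ripDl ripNl. Qed.

Lemma rip0l x : rip 0 x = 0.
Proof. by rewrite -(subrr x) ripBl subrr. Qed.

Lemma ripBr x y z : rip z (x - y) = rip z x - rip z y.
Proof. by rewrite ripDr ripNr. Qed.

Lemma nm_sqr x : nm x ^+ 2 = rip x x.
Proof.
apply: (@complexI R); rewrite rmorphXn/= -normE -inner_norm /rip.
by rewrite (RRe_real _)// inner_norm rpredX// normr_real.
Qed.

Lemma nm_sqrE x : inner x x = (nm x ^+ 2)%:C.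
Proof. by rewrite rmorphXn/= -normE inner_norm. Qed.

(** Multiplication by [i] turns the imaginary part into a real part up to sign. Identities stable
    under [i] can therefore be proved for [rip] and lifted to [inner]. *)
Lemma innerE x y : inner x y = (rip x y) -i* (rip ('i%C *: x) y).
Proof.
by rewrite /rip innerZl; case: (inner x y) => a b/=; rewrite !mul0r mul1r sub0r opprK.
Qed.

End Norm.

(** * Cauchy-Schwarz and best approximation for a real semidefinite form *)

Section RealForm.
Context {R : realType} {V : lmodType R[i]} (ip : V -> V -> R).
Hypothesis ipC : forall x y, ip x y = ip y x.
Hypothesis ipDl : forall x y z, ip (x + y) z = ip x z + ip y z.
Hypothesis ipZl : forall (c : R) x y, ip (c%:C *: x) y = c * ip x y.
Hypothesis ip_ge0 : forall x, 0 <= ip x x.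

Let ipDr x y z : ip z (x + y) = ip z x + ip z y.
Proof. by rewrite ipC ipDl !(ipC z). Qed.
Let ipZr (c : R) x y : ip x (c%:C *: y) = c * ip x y.
Proof. by rewrite ipC ipZl ipC. Qed.
Let ipNl x y : ip (- x) y = - ip x y.
Proof.
by rewrite (_ : - x = (-1 : R)%:C *: x) ?ipZl ?mulN1r// rmorphN1 scaleN1r.
Qed.
Let ipNr x y : ip x (- y) = - ip x y.
Proof. by rewrite ipC ipNl ipC. Qed.
Let ipE := (ipDl, ipDr, ipZl, ipZr, ipNl, ipNr).

Lemma quadratic_discr (a b g : R) :
  (forall c, 0 <= a - 2 * c * b + c ^+ 2 * g) -> 0 <= g -> b ^+ 2 <= a * g.
Proof.
move=> h g0.
have a0 : 0 <= a by have := h 0; rewrite !mulr0 mul0r expr0n/= mul0r subr0 addr0.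
have [g1|g1] := eqVneq g 0.
  rewrite g1 in h *; have [->|b0] := eqVneq b 0; first by rewrite expr0n/= mulr0.
  (* For [g = 0] the expression is affine in [c], and this [c] gives it the value [-1]. *)
  have := h ((a + 1) / (2 * b)).
  have -> : 2 * ((a + 1) / (2 * b)) * b = a + 1 by field.
  by rewrite mulr0; lra.
have gp : 0 < g by rewrite lt_def g1.
(* The minimiser of the quadratic. *)
have := h (b / g).
have -> : a - 2 * (b / g) * b + (b / g) ^+ 2 * g = (a * g - b ^+ 2) / g by field.
by rewrite pmulr_lge0 ?invr_gt0// subr_ge0.
Qed.

Lemma form_CauchySchwarz x y : ip x y ^+ 2 <= ip x x * ip y y.
Proof.
apply: quadratic_discr => // c.
have := ip_ge0 (x - c%:C *: y); rewrite !ipE (ipC y x); lra.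
Qed.

(* [G] need not be closed: [p] is the projection of [x] on its closure. *)
Lemma form_projection (G : set V) :
  (forall u : nat -> V,
    (forall e : R, 0 < e -> exists N, forall m n, (N <= m)%N -> (N <= n)%N ->
      ip (u m - u n) (u m - u n) < e) ->
    exists l, ip (u n - l) (u n - l) @[n --> \oo] --> (0 : R)) ->
  G 0 ->
  (forall (c : R) x y, G x -> G y -> G (c%:C *: x + y)) ->
  forall x, exists p,
    (exists2 u : nat -> V, forall n, G (u n)
                   & ip (u n - p) (u n - p) @[n --> \oo] --> (0 : R)) /\
    forall g, G g -> ip (x - p) g = 0.
Proof.
move=> cpl G0 Glin x.
pose q y := ip y y.
pose D := [set q (x - g) | g in G].
have D0 : D !=set0 by exists (q (x - 0)), 0.
have Dlb : has_lbound D by exists 0 => _ [g _ <-]; exact: ip_ge0.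
pose d := inf D.
have dle g : G g -> d <= q (x - g).
  by move=> Gg; apply: ge_inf => //; exists g.
have /choice[u uP] n : exists g, G g /\ q (x - g) < d + n.+1%:R^-1.
  have [||_ [g Gg <-] gd] := @inf_adherent _ D n.+1%:R^-1; [|by split|by exists g].
  by rewrite invr_gt0.
have Gu n : G (u n) by case: (uP n).
have ud n : q (x - u n) < d + n.+1%:R^-1 by case: (uP n).
(* Parallelogram law: the midpoint of [u m] and [u n] lies in [G], so its squared distance to [x] is
   at least [d]. The midpoint is built from [0] in two steps of the form [c x + y]. *)
have par m n : ip (u m - u n) (u m - u n) < 2 * (m.+1%:R^-1 + n.+1%:R^-1).
  have Gmid : G ((2^-1)%:C *: u m + ((2^-1)%:C *: u n + 0)).
    by apply: (Glin) => //; apply: Glin.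
  have := dle _ Gmid; have := ud m; have := ud n.
  rewrite /q addr0 !ipE (ipC (u m) x) (ipC (u n) x) (ipC (u n) (u m)).
  by move: (m.+1%:R^-1) (n.+1%:R^-1) => a b; lra.
have [|p up] := cpl u.
  move=> e e0.
  have e4 : 0 < e / 4 by lra.
  have := near_infty_natSinv_lt (PosNum e4) => -[N _ NP]/=.
  exists N => m n /NP/= hm /NP/= hn.
  apply: lt_trans (par m n) _; move: hm hn.
  by move: (m.+1%:R^-1) (n.+1%:R^-1) => a b; lra.
exists p; split; first by exists u.
move=> g Gg.
(* Moving [u n] inside [G] by a multiple of [g] lowers the squared distance by less than [1/(n+1)];
   the resulting quadratic in [c] is nonnegative. *)
have est n : ip (x - u n) g ^+ 2 <= n.+1%:R^-1 * ip g g.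
  apply: quadratic_discr => // c.
  have := dle _ (Glin c _ _ Gg (Gu n)); have := ud n.
  rewrite /q !ipE (ipC (u n) x) (ipC g x) (ipC g (u n)).
  by move: (n.+1%:R^-1) => a; lra.
apply/eqP; rewrite -sqrf_eq0 eq_le sqr_ge0 andbT.
(* Upper bound from [(s + t)^2 <= 2 s^2 + 2 t^2] after splitting [x - p] at [u n]: [est] controls
   the first term, Cauchy-Schwarz the second. *)
have lim0 : 2 * (n.+1%:R^-1 * ip g g) + 2 * (ip (u n - p) (u n - p) * ip g g)
    @[n --> \oo] --> 2 * (0 * ip g g) + 2 * (0 * ip g g).
  apply: cvgD; apply: cvgMl_tmp.
    by apply: cvgMr_tmp; exact: cvg_harmonic.
  by apply: cvgMr_tmp; exact: up.
rewrite !mul0r !mulr0 addr0 in lim0.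
apply: (cvgr_to_ge lim0) => //; apply: nearW => n.
have -> : ip (x - p) g = ip (x - u n) g + ip (u n - p) g.
  by rewrite -ipDl subrKA.
have := est n; have := form_CauchySchwarz (u n - p) g.
have := sqr_ge0 (ip (x - u n) g - ip (u n - p) g).
move: (n.+1%:R^-1) (ip (x - u n) g) (ip (u n - p) g) => c a b; nra.
Qed.
End RealForm.

Lemma gtc0_real (R : realType) (e : R[i]) : 0 < e -> exists2 r : R, 0 < r & e = r%:C.
Proof.
move=> e0; exists (complex.Re e); last by rewrite RRe_real// gtr0_real.
by rewrite -ltcR RRe_real// gtr0_real.
Qed.

Lemma ltr0c (R : realType) (r : R) : (0 < r%:C :> R[i]) = (0 < r).
Proof. by rewrite -ltcR. Qed.

Section LinearFun.
Context {K : pzRingType} {U V : lmodType K} (f : U -> V).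
Hypothesis lf : linear f.

Lemma linear_fun_sub x y : f (x - y) = f x - f y.
Proof. exact: (GRing.zmod_morphism_linear lf). Qed.

Lemma linear_fun_0 : f 0 = 0.
Proof. by rewrite -(subrr 0) linear_fun_sub subrr. Qed.

Lemma linear_fun_scale k x : f (k *: x) = k *: f x.
Proof. exact: (GRing.scalable_linear lf). Qed.

End LinearFun.

(** * Limits, Cauchy sequences and bounded operators in terms of [nm] *)

Section Limits.
Context {R : realType} {H : hilbertType R}.
Implicit Types (x y z l : H) (u : nat -> H).

Lemma rip_CauchySchwarz x y : `|rip x y| <= nm x * nm y.
Proof.
have rip_ge0 z : 0 <= rip z z by rewrite -nm_sqr sqr_ge0.
have := form_CauchySchwarz ripC ripDl ripZl rip_ge0 x y.
rewrite -!nm_sqr -exprMn -real_normK ?num_real// ler_pXn2r// ?nnegrE//.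
by rewrite mulr_ge0// nm_ge0.
Qed.

Lemma cvg_nm0 u l : u @ \oo --> l <-> nm (u n - l) @[n --> \oo] --> (0 : R).
Proof.
split=> [/cvgrPdist_lt ul|/cvgrPdist_lt ul]; apply/cvgrPdist_lt => e.
  move=> e0; have e0' : 0 < e%:C :> R[i] by rewrite ltr0c.
  apply: filterS (ul _ e0') => n.
  by rewrite sub0r normrN ger0_norm ?nm_ge0// normE ltcR nmB.
move=> /gtc0_real[r r0 ->]; apply: filterS (ul _ r0) => n.
by rewrite sub0r normrN ger0_norm ?nm_ge0// normE ltcR nmB.
Qed.

Lemma nm_complete u :
  (forall e : R, 0 < e -> exists N, forall m n, (N <= m)%N -> (N <= n)%N ->
    nm (u m - u n) < e) -> exists l, u @ \oo --> l.
Proof.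
move=> cu; suff /cauchy_cvgP cvgu : cauchy (u @ \oo) by exists (lim (u @ \oo)).
apply/cauchy_exP => _/gtc0_real[e e0 ->]; have [N NP] := cu _ e0.
exists (u N); exists N => // n/= Nn.
by rewrite -ball_normE/= normE ltcR NP.
Qed.

Lemma nm_cvg u l : u @ \oo --> l -> nm (u n) @[n --> \oo] --> nm l.
Proof.
move=> /cvg_nm0/cvgrPdist_lt ul; apply/cvgrPdist_lt => e /ul; apply: filterS => n.
rewrite sub0r normrN ger0_norm ?nm_ge0//; apply: le_lt_trans.
rewrite ler_norml; have := nmD (u n - l) l; have := nmD (l - u n) (u n).
by rewrite !subrK nmB; lra.
Qed.

Lemma cvg_dist_le (a b : nat -> R) (l : R) : (forall n, `|a n - l| <= b n) ->
  b @ \oo --> (0 : R) -> a @ \oo --> l.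
Proof.
move=> ab /cvgrPdist_lt b0; apply/cvgrPdist_lt => e /b0; apply: filterS => n.
rewrite sub0r normrN distrC => be; apply: le_lt_trans (ab n) _.
exact: le_lt_trans (ler_norm _) be.
Qed.

Lemma cvg_nm_le u (b : nat -> R) l : (forall n, nm (u n - l) <= b n) ->
  b @ \oo --> (0 : R) -> u @ \oo --> l.
Proof.
move=> ub b0; apply/cvg_nm0; apply: cvg_dist_le b0 => n.
by rewrite subr0 ger0_norm// nm_ge0.
Qed.

Lemma rip_cvg u l y : u @ \oo --> l -> rip (u n) y @[n --> \oo] --> rip l y.
Proof.
move=> /cvg_nm0 ul; apply: (@cvg_dist_le _ (fun n => nm (u n - l) * nm y)).
  by move=> n; rewrite -ripBl rip_CauchySchwarz.
by rewrite -(mul0r (nm y)); apply: cvgMr_tmp.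
Qed.

Lemma bounded_nm (f : H -> H) : bounded_operator f ->
  exists2 M : R, 0 <= M & forall x, nm (f x) <= M * nm x.
Proof.
move=> [_ [M MP]]; exists `|M| => // x.
have := MP x; rewrite !normE -rmorphM/= lecR => /le_trans; apply.
by rewrite ler_wpM2r ?nm_ge0// ler_norm.
Qed.

Lemma nm_bounded (f : H -> H) (M : R) : linear f ->
  (forall x, nm (f x) <= M * nm x) -> bounded_operator f.
Proof.
by move=> lf fM; split=> //; exists M => x; rewrite !normE -rmorphM/= lecR.
Qed.

Lemma bounded_cvg (f : H -> H) u l : bounded_operator f ->
  u @ \oo --> l -> f (u n) @[n --> \oo] --> f l.
Proof.
move=> bf /cvg_nm0 ul; have [M _ fM] := bounded_nm bf.
apply: (@cvg_nm_le _ (fun n => M * nm (u n - l))) => [n|].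
  by have [/linear_fun_sub <- _] := bf.
by rewrite -(mulr0 M); apply: cvgMl_tmp.
Qed.

Lemma nm_cauchy u l : u @ \oo --> l -> forall e : R, 0 < e ->
  exists N, forall m n, (N <= m)%N -> (N <= n)%N -> nm (u m - u n) < e.
Proof.
move=> /cvg_nm0/cvgrPdist_lt ul e e0.
have [N _ NP] := ul (e / 2) (divr_gt0 e0 (ltr0Sn _ 1)).
exists N => m n /NP/= + /NP/=.
rewrite !sub0r !normrN !ger0_norm ?nm_ge0// => mN nN.
by have := nmD (u m - l) (l - u n); rewrite subrKA (nmB l); lra.
Qed.

Lemma cvg_uniq u l l' : u @ \oo --> l -> u @ \oo --> l' -> l = l'.
Proof. exact: cvg_unique. Qed.

Lemma inner_symmetric (f : H -> H) x y : linear f ->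
  (forall x y, rip (f x) y = rip x (f y)) -> inner (f x) y = inner x (f y).
Proof. by move=> lf sf; rewrite !innerE -linear_fun_scale// !sf. Qed.

End Limits.

(** * Square root of [1 - A] for a symmetric contraction [A] *)

Section ContractionSqrt.
Context {R : realType} {H : hilbertType R}.

(** The sequence increases and stays below 1, hence converges. Its Cauchy estimate carries over to
    the operator iteration, vector by vector. *)
Lemma half_sqr_iter_cauchy (r : nat -> R) : r 0 = 0 ->
  (forall n, r n.+1 = 2^-1 * (1 + r n ^+ 2)) ->
  [/\ forall n, 0 <= r n <= 1, forall n, r n <= r n.+1 &
   forall e : R, 0 < e -> exists N, forall n m, (N <= n)%N -> (n <= m)%N ->
     r m - r n < e].
Proof.
move=> r0 rS.
have r01 n : 0 <= r n <= 1 by elim: n => [|n /andP[]]; rewrite ?r0 ?rS; nra.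
have rinc n : r n <= r n.+1 by have := r01 n; rewrite rS; nra.
split=> // e e0.
have : cvgn r.
  apply: nondecreasing_is_cvgn; first by apply/nondecreasing_seqP.
  by exists 1 => _ [n _ <-]; case/andP: (r01 n).
move=> /cvgrPdist_lt/(_ (e / 2)); rewrite divr_gt0// => /(_ isT)[N _ NP].
exists N => n m Nn nm'; have /= := NP _ Nn; have /= := NP m (leq_trans Nn nm').
move: (limn r) => l; rewrite !ltr_norml; lra.
Qed.

(** [S = 1 - Y], where [Y] is the pointwise limit of the iterates and a fixed point of
    [Y = (A + Y^2) / 2]. The bound on [x - S x] yields positivity of [S] through Cauchy-Schwarz; the
    last clause passes commutation from [A] to its root. *)
Lemma contraction_sqrt (A : H -> H) :
  linear A -> (forall x y, rip (A x) y = rip x (A y)) ->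
  (forall x, nm (A x) <= nm x) ->
  exists S : H -> H,
    [/\ linear S, forall x y, rip (S x) y = rip x (S y),
        forall x, nm (x - S x) <= nm x,
        forall x, S (S x) = x - A x &
        forall F, bounded_operator F -> (forall x, F (A x) = A (F x)) ->
          forall x, F (S x) = S (F x)].
Proof.
move=> lA sA bA.
pose X := fix X n x : H := if n is n'.+1 then (2^-1 : R)%:C *: (A x + X n' (X n' x)) else 0.
pose r := fix r n : R := if n is n'.+1 then 2^-1 * (1 + r n' ^+ 2) else 0.
have [r01 rinc rcau] := @half_sqr_iter_cauchy r erefl (fun=> erefl).
have lX n : linear (X n).
  elim: n => [|n IHn] k x y /=; first by rewrite scaler0 addr0.
  by rewrite lA !IHn !scalerDr !scalerA (mulrC k) addrACA.
have half0 : 0 <= 2^-1 :> R by rewrite invr_ge0.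
have sX n x y : rip (X n x) y = rip x (X n y).
  elim: n x y => [|n IHn] x y /=; first by rewrite -(scale0r 0) ripZl ripZr !mul0r.
  by rewrite ripZl ripZr ripDl ripDr sA !IHn.
have bX n x : nm (X n x) <= r n * nm x.
  elim: n x => [|n IHn] x /=; first by rewrite nm0 mul0r.
  rewrite nmZr// -mulrA ler_wpM2l//; apply: le_trans (nmD _ _) _.
  have := bA x; have := IHn x; have := IHn (X n x); have := r01 n; nra.
have dX n x : nm (X n.+1 x - X n x) <= (r n.+1 - r n) * nm x.
  elim: n x => [|n IHn] x.
    by rewrite /= subr0 !expr0n !addr0 mulr1 subr0 nmZr// ler_wpM2l.
  (* With [P = X n.+1] and [Q = X n], the difference of squares is written [P (P - Q) + (P - Q) Q],
     which needs no commutation; [r] is split in the same way. *)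
  have -> : X n.+2 x - X n.+1 x = (2^-1 : R)%:C *:
      (X n.+1 (X n.+1 x - X n x) + (X n.+1 (X n x) - X n (X n x))).
    by rewrite (linear_fun_sub (lX n.+1)) subrKA -scalerBr opprD addrACA subrr add0r.
  rewrite nmZr//.
  have -> : r n.+2 - r n.+1 = 2^-1 * (r n.+1 * (r n.+1 - r n) + (r n.+1 - r n) * r n).
    by rewrite /=; ring.
  rewrite -mulrA ler_wpM2l//; apply: le_trans (nmD _ _) _.
  rewrite mulrDl; apply: lerD.
    apply: le_trans (bX _ _) _; rewrite -mulrA ler_wpM2l//.
    by case/andP: (r01 n.+1).
  apply: le_trans (IHn _) _; rewrite -mulrA ler_wpM2l// subr_ge0//.
have ddX n k x : nm (X (n + k)%N x - X n x) <= (r (n + k)%N - r n) * nm x.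
  elim: k => [|k IHk]; first by rewrite addn0 !subrr nm0 mul0r.
  rewrite addnS; have := dX (n + k)%N x.
  have := nmD (X (n + k).+1 x - X (n + k)%N x) (X (n + k)%N x - X n x).
  by rewrite subrKA; lra.
have : forall x, exists y : H, (fun n => X n x) @ \oo --> y.
  move=> x.  apply: (@nm_complete _ _ (fun n => X n x)) => e e0.
  (* The added 1 keeps the denominator positive when [x = 0]. *)
  have e1 : 0 < e / (nm x + 1) by rewrite divr_gt0// ltr_wpDl// nm_ge0.
  have [N NP] := rcau _ e1.
  have step m n : (N <= n)%N -> (n <= m)%N -> nm (X m x - X n x) < e.
    move=> Nn nm'; have := NP _ _ Nn nm'; rewrite ltr_pdivlMr ?ltr_wpDl ?nm_ge0// => h.
    have := ddX n (m - n)%N x; rewrite subnKC// => /le_lt_trans; apply.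
    have rnm : r n <= r m by have /nondecreasing_seqP := rinc; apply.
    by apply: le_lt_trans h; rewrite ler_wpM2l ?subr_ge0// lerDl.
  exists N => m n Nm Nn; have [nm'|mn] := leqP n m; first exact: step.
  by rewrite nmB; apply: step => //; exact: ltnW.
move=> /choice[Y XY].
have lY : linear Y.
  move=> k x y; apply: (cvg_uniq (XY (k *: x + y))).
  under eq_fun do rewrite lX.
  by apply: cvgD (XY y); exact: cvgZl_tmp (XY x).
have sY x y : rip (Y x) y = rip x (Y y).
  have h1 := rip_cvg (y := y) (XY x); have h2 := rip_cvg (y := x) (XY y).
  rewrite (_ : (fun n => rip (X n y) x) = (fun n => rip (X n x) y)) in h2.
    by rewrite (ripC x); exact: cvg_unique h1 h2.
  by apply/funext => n; rewrite sX ripC.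
have bY x : nm (Y x) <= nm x.
  apply: (cvgr_to_le (nm_cvg (XY x))); apply: nearW => n.
  by have := bX n x; have := r01 n; have := nm_ge0 x; nra.
have BY : bounded_operator Y by apply: (@nm_bounded _ _ _ 1) => // x; rewrite mul1r.
have YE x : Y x = (2^-1 : R)%:C *: (A x + Y (Y x)).
  apply: (@cvg_uniq _ _ (fun n => X n.+1 x)).
    by have := XY x; rewrite -(@cvg_shiftS _ (fun n => X n x)).
  apply: cvgZl_tmp; apply: cvgD; first exact: cvg_cst.
  (* Insert [X n (Y x)] between [X n (X n x)] and [Y (Y x)]; the first difference is bounded because
     [X n] is a contraction. *)
  apply: (@cvg_nm_le _ _ _ (fun n => nm (X n x - Y x) + nm (X n (Y x) - Y (Y x)))) => [n|].
    rewrite -(subrKA (X n (Y x))) -(linear_fun_sub (lX n)); apply: le_trans (nmD _ _) _.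
    rewrite lerD2r; have := bX n (X n x - Y x); have := r01 n.
    by have := nm_ge0 (X n x - Y x); nra.
  by rewrite -(addr0 0); apply: cvgD; apply/cvg_nm0.
exists (fun x => x - Y x); split.
- by move=> k x y; rewrite lY scalerBr opprD addrACA.
- by move=> x y; rewrite ripBl ripBr sY.
- by move=> x; rewrite opprB addrC subrK.
(* The fixed-point equation reads [2 Y = A + Y^2], so [(1 - Y)^2 = 1 - 2 Y + Y^2 = 1 - A]. *)
- move=> x; rewrite (linear_fun_sub lY).
  have : Y x + Y x = A x + Y (Y x).
    rewrite -mulr2n -scaler_nat {1}YE scalerA; move: (A x + _) => z.
    by rewrite -[2]/(2%:R) -(rmorph_nat (real_complex R)) -rmorphM/= mulfV// scale1r.
  move=> h; rewrite (_ : A x = Y x + Y x - Y (Y x)); last by rewrite h addrK.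
  by rewrite !opprB !addrA opprD !addrA (addrAC x).
- move=> F bF FA x; have [lF _] := bF; rewrite (linear_fun_sub lF); congr (_ - _).
  (* Each [X n] is a polynomial in [A]; boundedness of [F] then carries commutation to the limit. *)
  have FX n z : F (X n z) = X n (F z).
    elim: n z => [|n IHn] z /=; first by rewrite (linear_fun_0 lF).
    rewrite (linear_fun_scale lF) -[A z]scale1r lF scale1r FA; congr (_ *: (_ + _)).
    by rewrite !IHn.
  apply: (cvg_uniq (bounded_cvg bF (XY x))).
  by under eq_fun do rewrite FX; exact: XY.
Qed.
End ContractionSqrt.

(** * Density and orthogonality *)

Section Dense.
Context {R : realType} {H : hilbertType R}.

Lemma dense_seq (S : set H) : dense S ->
  forall x : H, exists2 u : nat -> H, forall n, S (u n) & u @ \oo --> x.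
Proof.
move=> dS x.
have /choice[u uP] n : exists y, S y /\ nm (y - x) <= n.+1%:R^-1.
  have n0 : 0 < (n.+1%:R^-1)%:C :> R[i] by rewrite ltr0c invr_gt0.
  have [|y [xy Sy]] := dS (ball x (n.+1%:R^-1)%:C) _ (ball_open x _).
    by exists x; exact: ballxx.
  exists y; split=> //; move: xy; rewrite -ball_normE/= normE ltcR nmB.
  exact: ltW.
exists u => [n|]; first by case: (uP n).
by apply: cvg_nm_le cvg_harmonic => n; case: (uP n).
Qed.

Lemma dense_orthogonal (S : set H) z : dense S ->
  (forall x, S x -> rip x z = 0) -> z = 0.
Proof.
move=> dS Sz; have [u Su uz] := dense_seq dS z.
apply: nm_eq0; apply/eqP; rewrite -sqrf_eq0 nm_sqr; apply/eqP.
have := rip_cvg (y := z) uz.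
under eq_fun do rewrite Sz//.
by move=> /(cvg_unique _ (cvg_cst _)) ->.
Qed.

Lemma dense_sub (S T : set H) : S `<=` T -> dense S -> dense T.
Proof.
by move=> ST dS O O0 oO; have [x [Ox Sx]] := dS O O0 oO; exists x; split=> //; exact: ST.
Qed.

End Dense.

Lemma cvg_sqr_le (R : realType) (a b : nat -> R) : (forall n, a n ^+ 2 <= b n) ->
  b @ \oo --> (0 : R) -> a @ \oo --> (0 : R).
Proof.
move=> ab /cvgrPdist_lt b0; apply/cvgrPdist_lt => e e0.
have e2 : 0 < e ^+ 2 by rewrite exprn_gt0.
apply: filterS (b0 _ e2) => n; rewrite !sub0r !normrN => be.
rewrite -(@ltr_pXn2r _ 2)// ?nnegrE ?ltW// real_normK ?num_real//.
by apply: le_lt_trans (ab n) _; apply: le_lt_trans be; exact: ler_norm.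
Qed.

(** * Projection in the Hilbert sum of [H] and [K] *)

Section Pairs.
Context {R : realType} {H K : hilbertType R}.

(** The form is the sum of the two inner products. It dominates the squared norm of each component,
    so completeness and limits are treated componentwise. *)
Lemma pair_projection (G : set (H * K)) : G 0 ->
  (forall (c : R) x y, G x -> G y -> G (c%:C *: x + y)) ->
  forall x, exists p : H * K,
    (exists u : nat -> H * K, [/\ forall n, G (u n),
       (u n).1 @[n --> \oo] --> p.1 & (u n).2 @[n --> \oo] --> p.2]) /\
    forall g, G g -> rip (x.1 - p.1) g.1 + rip (x.2 - p.2) g.2 = 0.
Proof.
move=> G0 Glin x.
pose ip (p q : H * K) := rip p.1 q.1 + rip p.2 q.2.
have ipE p : ip p p = nm p.1 ^+ 2 + nm p.2 ^+ 2 by rewrite !nm_sqr.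
have ip1 p : nm p.1 ^+ 2 <= ip p p by rewrite ipE lerDl sqr_ge0.
have ip2 p : nm p.2 ^+ 2 <= ip p p by rewrite ipE lerDr sqr_ge0.
have lt_nm a e : 0 <= a -> 0 < e -> a ^+ 2 < e ^+ 2 -> a < e :> R.
  by move=> a0 e0; rewrite ltr_pXn2r// nnegrE ltW.
have [|||||p [[u Gu up] pG]] := @form_projection R (H * K)%type ip _ _ _ _ G _ G0 Glin x.
- by move=> p q; rewrite /ip !(ripC p.1) !(ripC p.2).
- by move=> p q r; rewrite /ip !ripDl addrACA.
- by move=> c p q; rewrite /ip !ripZl mulrDr.
- by move=> p; rewrite ipE addr_ge0// sqr_ge0.
- move=> u cu.
  have cu' e : 0 < e -> exists N, forall m n, (N <= m)%N -> (N <= n)%N ->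
      nm ((u m).1 - (u n).1) < e /\ nm ((u m).2 - (u n).2) < e.
    move=> e0; have [|N NP] := cu (e ^+ 2); first by rewrite exprn_gt0.
    exists N => m n Nm Nn; have h := NP _ _ Nm Nn.
    split; apply: lt_nm => //; try exact: nm_ge0.
      by apply: le_lt_trans h; exact: (ip1 (u m - u n)).
    by apply: le_lt_trans h; exact: (ip2 (u m - u n)).
  have [e /cu'[N NP]|l1 ul1] := @nm_complete _ _ (fun n => (u n).1).
    by exists N => m n Nm Nn; have [] := NP _ _ Nm Nn.
  have [e /cu'[N NP]|l2 ul2] := @nm_complete _ _ (fun n => (u n).2).
    by exists N => m n Nm Nn; have [] := NP _ _ Nm Nn.
  exists (l1, l2); under eq_fun do rewrite ipE/=.
  move/cvg_nm0 : ul1 => ul1; move/cvg_nm0 : ul2 => ul2.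
  by rewrite -(addr0 0) -(mulr0 0); apply: cvgD; apply: cvgM.
exists p; split=> //; exists u; split=> //; apply/cvg_nm0.
  by apply: cvg_sqr_le up => n; exact: (ip1 (u n - p)).
by apply: cvg_sqr_le up => n; exact: (ip2 (u n - p)).
Qed.

End Pairs.

(** * Modulus of the closed densely defined operator with graph [G] *)

Section Modulus.
Context {R : realType} {H K : hilbertType R} (G : set (H * K)).
Hypothesis G0 : G 0.
Hypothesis Glin : forall (k : R[i]) x y, G x -> G y -> G (k *: x + y).
Hypothesis Gclosed : forall (u : nat -> H * K) p, (forall n, G (u n)) ->
  (u n).1 @[n --> \oo] --> p.1 -> (u n).2 @[n --> \oo] --> p.2 -> G p.
Hypothesis Gfun : forall y, G (0, y) -> y = 0.
Hypothesis Gdense : dense [set x | exists y, G (x, y)].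

Let GB x y x' y' : G (x, y) -> G (x', y') -> G (x - x', y - y').
Proof.
move=> h h'; suff -> : (x - x', y - y') = -1 *: (x', y') + (x, y) by exact: Glin.
by rewrite scaleN1r [RHS]addrC.
Qed.

Let Gfun2 x y y' : G (x, y) -> G (x, y') -> y = y'.
Proof.
by move=> h h'; apply/eqP; rewrite -subr_eq0; apply/eqP/Gfun; rewrite -(subrr x); apply: GB.
Qed.

(* [(BT z).1] is (1 + T^*T)^-1 z for the operator T whose graph is [G]. *)
Lemma resolvent : exists BT : H -> H * K, [/\ 
  forall z, G (BT z),
  forall z g, G g -> rip (BT z).1 g.1 + rip (BT z).2 g.2 = rip z g.1 &
  forall k x y, BT (k *: x + y) = k *: BT x + BT y].
Proof.
have /choice[BT BTP] z : exists p, G p /\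
    forall g, G g -> rip p.1 g.1 + rip p.2 g.2 = rip z g.1.
  have [c x y|p [[u [Gu u1 u2]] pG]] := @pair_projection _ H K G G0 _ (z, 0).
    exact: Glin.
  exists p; split; first exact: Gclosed Gu u1 u2.
  by move=> g /pG; rewrite /= ripBl sub0r ripNl; lra.
exists BT; split=> [z|z|k x y]; [by case: (BTP z)|by case: (BTP z)|].
have [Gx xE] := BTP x; have [Gy yE] := BTP y; have [Gxy xyE] := BTP (k *: x + y).
(* [BT (k *: x + y)] and [p] represent the same functional on [G], so their difference, which lies
   in [G], is orthogonal to itself. The complex scalar [k] passes to [g] as its conjugate. *)
set p := k *: BT x + BT y; have Gp : G p by apply: Glin.
have Gd : G (BT (k *: x + y) - p) by have := Glin (-1) Gp Gxy; rewrite scaleN1r [X in G X]addrC.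
have pE g : G g -> rip p.1 g.1 + rip p.2 g.2 = rip (k *: x + y) g.1.
  move=> Gg; have := xE (conjc k *: g + 0) (Glin _ Gg G0); have := yE g Gg.
  by rewrite addr0 /p/= !ripDl !ripZC; lra.
set d := BT _ - p in Gd *.
have /eqP : nm d.1 ^+ 2 + nm d.2 ^+ 2 = 0.
  by have := xyE _ Gd; have := pE _ Gd; rewrite !nm_sqr !ripBl; lra.
rewrite paddr_eq0 ?sqr_ge0// !sqrf_eq0 => /andP[/eqP/nm_eq0 d1 /eqP/nm_eq0 d2].
by apply/eqP; rewrite -subr_eq0; apply/eqP/pair_equal_spec.
Qed.

Lemma modulus : exists W : operator H,
  [/\ positive_operator W /\ selfadjoint W,
      forall x, op_dom W x <-> exists y, G (x, y) &
      forall x y x' y', G (x, y) -> G (x', y') -> inner (W x) (W x') = inner y y'].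
Proof.
have [BT [GBT BTE BTlin]] := resolvent.
pose B z := (BT z).1; pose T z := (BT z).2.
have GBz z : G (B z, T z) by rewrite /B /T -surjective_pairing.
have lB : linear B by move=> k x y; rewrite /B BTlin.
have lT : linear T by move=> k x y; rewrite /T BTlin.
have BE z : rip (B z) z = nm (B z) ^+ 2 + nm (T z) ^+ 2.
  by rewrite !nm_sqr ripC -(BTE z _ (GBT z)).
have sB x y : rip (B x) y = rip x (B y).
  rewrite ripC -(BTE y _ (GBT x)) -(BTE x _ (GBT y)).
  by rewrite !(ripC (BT y).1) !(ripC (BT y).2).
have nB x : nm (B x) <= nm x.
  have := rip_CauchySchwarz (B x) x; rewrite BE ger0_norm ?addr_ge0 ?sqr_ge0//.
  have := nm_ge0 x; have := sqr_ge0 (nm (T x)) => t0 x0.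
  by move=> h; rewrite leNgt; apply/negP => lt; nra.
pose A x := x - B x.
have lA : linear A by move=> k x y; rewrite /A lB scalerBr opprD addrACA.
have sA x y : rip (A x) y = rip x (A y) by rewrite ripBl ripBr sB.
have nA x : nm (A x) <= nm x.
  (* [|A x|^2 = |x|^2 - |B x|^2 - 2 |T x|^2]. *)
  rewrite -(@ler_pXn2r _ 2)// ?nnegrE ?nm_ge0// nm_sqr /A !ripBl !ripBr (ripC x (B x)).
  by have := BE x; rewrite -!nm_sqr; have := sqr_ge0 (nm (T x)); have := sqr_ge0 (nm (B x)); lra.
(* Roots are taken of 1 minus the argument: [C^2 = 1 - A = B] and [D^2 = 1 - B]. *)
have [C [lC sC nC CC comC]] := contraction_sqrt lA sA nA.
have [D [lD sD nD DD comD]] := contraction_sqrt lB sB nB.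
have {}CC x : C (C x) = B x by rewrite CC /A opprB addrC subrK.
have bnd (S : H -> H) : linear S -> (forall x, nm (x - S x) <= nm x) -> bounded_operator S.
  move=> lS nS; apply: (@nm_bounded _ _ _ 2) => // x.
  have := nmD x (S x - x); rewrite (addrC x) subrK nmB; have := nS x; lra.
have bC := bnd C lC nC; have bD := bnd D lD nD.
have BD x : B x = x - D (D x) by rewrite DD opprB addrC subrK.
have DC x : D (C x) = C (D x).
  (* [D] commutes with [A = D^2], hence with [C]. *)
  apply: comC => // y; rewrite /A !BD !opprB !addrA !(addrC _ (D (D _))).
  by rewrite !addrK.
(* With E = C^(1/2), which commutes with D, <D u, C u> = <D E u, E u>. *)
have CDpos u : 0 <= rip (D u) (C u).
  have [|||E [lE sE nE EE comE]] := @contraction_sqrt _ _ (fun x => x - C x).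
  - by move=> k x y; rewrite lC scalerBr opprD addrACA.
  - by move=> x y; rewrite ripBl ripBr sC.
  - exact: nC.
  have -> : C u = E (E u) by rewrite EE opprB addrC subrK.
  rewrite -sE -comE => [| //|x]; last by rewrite (linear_fun_sub lD) DC.
  (* With [e = E u], [|e - D e| <= |e|] gives [<e - D e, e> <= |e|^2], that is [<D e, e> >= 0]. *)
  have := rip_CauchySchwarz (E u - D (E u)) (E u); rewrite ripBl -nm_sqr ler_norml.
  have := nD (E u); have := nm_ge0 (E u); nra.
(* The vectors (B z, T z) are dense in [G], because an element of [G] orthogonal
   to all of them has a first component orthogonal to every z. *)
have Bdense x y : G (x, y) -> exists z : nat -> H,
    B (z n) @[n --> \oo] --> x /\ T (z n) @[n --> \oo] --> y.
  move=> Gxy.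
  have [||p [[u [Gu u1 u2]] pG]] := @pair_projection _ H K (range BT) _ _ (x, y).
  - by exists 0 => //; exact: linear_fun_0 BTlin.
  - by move=> c _ _ [a _ <-] [b _ <-]; exists (c%:C *: a + b).
  have /choice[z zP] n : exists a, BT a = u n by have [a _] := Gu n; exists a.
  have Gp : G p by apply: Gclosed u1 u2 => n; rewrite -zP.
  have Gxp : G (x - p.1, y - p.2) by apply: GB => //; rewrite -surjective_pairing.
  have xp : x = p.1.
    apply/eqP; rewrite -subr_eq0; apply/eqP/nm_eq0/eqP; rewrite -sqrf_eq0 nm_sqr.
    rewrite -(BTE _ _ Gxp)/= (ripC (B _)) (ripC (T _)); apply/eqP/pG.
    by exists (x - p.1).
  have yp : y = p.2 by apply: (Gfun2 Gxy); rewrite xp -surjective_pairing.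
  exists z; rewrite xp yp; split.
    by under eq_fun do rewrite /B zP.
  by under eq_fun do rewrite /T zP.
have nCB z : nm (C z) ^+ 2 = nm (B z) ^+ 2 + nm (T z) ^+ 2.
  by rewrite nm_sqr sC CC ripC BE.
(* |C z|^2 = |B z|^2 + |T z|^2 makes C z |-> (B z, T z) isometric. *)
have ranC x y : G (x, y) -> exists2 u, C u = x & nm u ^+ 2 = nm x ^+ 2 + nm y ^+ 2.
  move=> /Bdense[z [Bz Tz]].
  have [e e0|u Czu] := @nm_complete _ _ (fun n => C (z n)).
    have e2 : 0 < e / 2 by rewrite divr_gt0.
    have [N1 B1] := nm_cauchy Bz e2; have [N2 T2] := nm_cauchy Tz e2.
    exists (maxn N1 N2) => m n; rewrite !geq_max => /andP[m1 m2] /andP[n1 n2].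
    have := B1 _ _ m1 n1; have := T2 _ _ m2 n2; have := nCB (z m - z n).
    rewrite (linear_fun_sub lC) (linear_fun_sub lB) (linear_fun_sub lT).
    move: (nm_ge0 (B (z m) - B (z n))) (nm_ge0 (T (z m) - T (z n))) => b0 t0 h tlt blt.
    rewrite -(@ltr_pXn2r _ 2)// ?nnegrE ?nm_ge0// ?(ltW e0)// h; nra.
  exists u.
    apply: (cvg_uniq (bounded_cvg bC Czu)).
    by under eq_fun do rewrite CC.
  have h1 : nm (C (z n)) ^+ 2 @[n --> \oo] --> nm u ^+ 2.
    by apply: cvgM; exact: nm_cvg.
  have h2 : nm (B (z n)) ^+ 2 + nm (T (z n)) ^+ 2 @[n --> \oo] --> nm x ^+ 2 + nm y ^+ 2.
    by apply: cvgD; apply: cvgM; exact: nm_cvg.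
  rewrite -(funext (fun n => nCB (z n))) in h2.
  exact: cvg_unique h1 h2.
have Cdense (u : H) : exists z : nat -> H, C (z n) @[n --> \oo] --> u.
  have [x xP xu] := dense_seq Gdense u.
  have /choice[z zP] n : exists a, C a = x n by have [y /ranC[a]] := xP n; exists a.
  by exists z; under eq_fun do rewrite zP.
have Cinj (u : H) : C u = 0 -> u = 0.
  (* [C u = 0] forces [B u = 0], then [T u = 0] since [G] is a graph; the defining identity of
     [BT u] makes [u] orthogonal to the dense domain. *)
  move=> Cu0; apply: (dense_orthogonal Gdense) => x [y Gxy].
  have := BTE u _ Gxy; rewrite -/(B u) -/(T u).
  have Bu0 : B u = 0 by rewrite -CC Cu0 (linear_fun_0 lC).
  rewrite Bu0 (@Gfun (T u)) -?Bu0// Bu0.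
  by rewrite !rip0l addr0 ripC.
have CI u u' : C u = C u' -> u = u'.
  by move=> uu; apply/eqP; rewrite -subr_eq0; apply/eqP/Cinj; rewrite (linear_fun_sub lC) uu subrr.
have Cran (u : H) : exists y, G (C u, y).
  (* If [C (z n)] tends to [u], then [B (z n) = C (C (z n))] tends to [C u], while [T (z n)] is
     Cauchy because [|T z| <= |C z|]; [G] is closed. *)
  have [z Czu] := Cdense u.
  have [e e0|y Tzy] := @nm_complete _ _ (fun n => T (z n)).
    have [N NP] := nm_cauchy Czu e0; exists N => m n Nm Nn.
    apply: le_lt_trans (NP _ _ Nm Nn); rewrite -(@ler_pXn2r _ 2)// ?nnegrE ?nm_ge0//.
    by rewrite -(linear_fun_sub lC) -(linear_fun_sub lT) nCB lerDr sqr_ge0.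
  exists y; apply: (@Gclosed (fun n => BT (z n))) => //=.
  by have := bounded_cvg bC Czu; rewrite (funext (fun n => CC (z n))).
(* [|y|^2 = |u|^2 - |C u|^2 = <(1 - B) u, u> = |D u|^2]. *)
have GD2 u y : G (C u, y) -> rip y y = rip (D u) (D u).
  move=> /ranC[u' /CI-> nu]; rewrite -nm_sqr.
  rewrite -sD DD ripBl BE -nm_sqr nu; have := nCB u; rewrite nm_sqr; lra.
have GD u y u' y' : G (C u, y) -> G (C u', y') -> rip y y' = rip (D u) (D u').
  move=> Gu Gu'; have := GD2 _ _ Gu; have := GD2 _ _ Gu'.
  (* Polarisation: [GD2] is applied to the sum. *)
  have : G (C (1 *: u + u'), 1 *: y + y') by rewrite lC; exact: Glin Gu Gu'.
  move=> /GD2; rewrite !scale1r -[u]scale1r lD !scale1r !ripDl !ripDr.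
  by rewrite (ripC y') (ripC (D u')); lra.
have GDi u y u' y' : G (C u, y) -> G (C u', y') -> inner y y' = inner (D u) (D u').
  move=> Gu Gu'; rewrite !innerE (GD _ _ _ _ Gu Gu') -(linear_fun_scale lD).
  congr (_ -i* _); apply: GD => //; have := Glin 'i%C Gu G0.
  by rewrite addr0 (linear_fun_scale lC).
(* The default 0 occurs only off the range of [C], outside the domain of the operator. *)
pose cinv x := xget 0 [set u | C u = x].
have cinvK u : cinv (C u) = u.
  by apply: CI; have := @xgetPex _ 0 [set u' | C u' = C u] (ex_intro _ u erefl).
pose dom : set H := range C.
have dom0 : dom 0 by exists 0 => //; rewrite (linear_fun_0 lC).
have domP (k : R[i]) x y : dom x -> dom y -> dom (k *: x + y).
  by move=> [u _ <-] [u' _ <-]; exists (k *: u + u') => //; rewrite lC.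
have domL (k : R[i]) x y : dom x -> dom y ->
    D (cinv (k *: x + y)) = k *: D (cinv x) + D (cinv y).
  by move=> [u _ <-] [u' _ <-]; rewrite -lC !cinvK lD.
have iC x y : inner (C x) y = inner x (C y) by apply: inner_symmetric.
have iD x y : inner (D x) y = inner x (D y) by apply: inner_symmetric.
exists (Operator dom0 domP domL); split; [split; [|split]| |].
- move=> _ [u _ <-] /=; rewrite cinvK innerE lecE/= CDpos andbT oppr_eq0.
  (* [C] and [D] are symmetric and commute, so [<D u, C u>] is real. *)
  have h : rip ('i%C *: D u) (C u) = - rip ('i%C *: D u) (C u).
    rewrite {1}ripZC -(linear_fun_scale lC) -sC -DC sD (linear_fun_scale lD) ripC.
    rewrite (_ : conjc 'i%C = - 'i%C) ?scaleNr ?ripNl//.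
    by rewrite /conjc/=; apply/eqP; rewrite eq_complex/= oppr0 !eqxx.
  by apply/eqP; lra.
- by apply: dense_sub Gdense => x [y /ranC[u ux _]]; exists u.
- move=> y z; split=> [adj|[[u _ <-] <-] _ [u' _ <-]] /=; last first.
    by rewrite !cinvK iD DC -iC.
  (* On a domain vector [C d] the adjoint relation reads [<D d, y> = <C d, z>]; it is tested with
     [d = D y - C z]. *)
  have DyCz : D y = C z.
    apply/eqP; rewrite -subr_eq0; apply/eqP/nm_eq0/eqP; rewrite -sqrf_eq0 nm_sqr.
    set d := D y - C z; rewrite {2}/d ripBr -sD -sC.
    have := adj (C d); rewrite /= cinvK /rip => ->; last by exists d.
    by rewrite subrr.
  (* By [C^2 + D^2 = 1] and [D y = C z], [y = C^2 y + D^2 y = C (C y + D z)]; likewise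
     [D (C y + D z) = C^2 z + D^2 z = z]. *)
  have yE : C (C y + D z) = y.
    rewrite -[C y]scale1r lC scale1r CC -DC -DyCz DD addrC subrK//.
  split; first by exists (C y + D z).
  have -> : cinv y = C y + D z by rewrite -{1}yE cinvK.
  rewrite -[C y]scale1r lD scale1r DC DyCz CC DD addrC subrK//.
- move=> x; split=> [[u _ <-]|[y /ranC[u ux _]]]; last by exists u.
  exact: Cran.
- move=> x y x' y' Gx Gx'; have [u xu _] := ranC _ _ Gx; have [u' xu' _] := ranC _ _ Gx'.
  by rewrite -xu -xu' /= !cinvK; apply/esym/GDi; rewrite ?xu ?xu'.
Qed.
End Modulus.

(** * Closure of a relation between [H] and [K] *)

Section PairClosure.
Context {R : realType} {H K : hilbertType R} (S : set (H * K)).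

(** The epsilon form makes closedness an [e / 2] argument instead of a diagonal sequence. *)
Definition pair_closure : set (H * K) := [set p | forall e : R, 0 < e ->
  exists2 q, S q & nm (q.1 - p.1) < e /\ nm (q.2 - p.2) < e].

Lemma pair_closureP p : pair_closure p <-> exists u : nat -> H * K,
  [/\ forall n, S (u n), (u n).1 @[n --> \oo] --> p.1 & (u n).2 @[n --> \oo] --> p.2].
Proof.
split=> [Sp|[u [Su u1 u2]] e e0].
  have /choice[u uP] n : exists q, S q /\
      nm (q.1 - p.1) <= n.+1%:R^-1 /\ nm (q.2 - p.2) <= n.+1%:R^-1.
    have [|q Sq [q1 q2]] := Sp n.+1%:R^-1; first by rewrite invr_gt0.
    by exists q; split=> //; split; exact: ltW.
  exists u; split=> [n||]; first by case: (uP n).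
    by apply: cvg_nm_le cvg_harmonic => n; have [_ []] := uP n.
  by apply: cvg_nm_le cvg_harmonic => n; have [_ []] := uP n.
move/cvg_nm0/cvgrPdist_lt/(_ _ e0) : u1 => [N1 _ NP1].
move/cvg_nm0/cvgrPdist_lt/(_ _ e0) : u2 => [N2 _ NP2].
exists (u (maxn N1 N2)) => //.
have /= := NP1 _ (leq_maxl N1 N2); have /= := NP2 _ (leq_maxr N1 N2).
by rewrite !sub0r !normrN !ger0_norm ?nm_ge0.
Qed.

Lemma sub_pair_closure : S `<=` pair_closure.
Proof. by move=> p Sp e e0; exists p => //; rewrite !subrr !nm0. Qed.

Lemma pair_closure_closed (u : nat -> H * K) p : (forall n, pair_closure (u n)) ->
  (u n).1 @[n --> \oo] --> p.1 -> (u n).2 @[n --> \oo] --> p.2 -> pair_closure p.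
Proof.
move=> Su u1 u2 e e0; have e2 : 0 < e / 2 by rewrite divr_gt0.
move/cvg_nm0/cvgrPdist_lt/(_ _ e2) : u1 => [N1 _ NP1].
move/cvg_nm0/cvgrPdist_lt/(_ _ e2) : u2 => [N2 _ NP2].
set n := maxn N1 N2; have [q Sq [q1 q2]] := Su n _ e2; exists q => //.
have /= := NP1 n (leq_maxl N1 N2); have /= := NP2 n (leq_maxr N1 N2).
rewrite !sub0r !normrN !ger0_norm ?nm_ge0// => p2 p1.
have := nmD (q.1 - (u n).1) ((u n).1 - p.1).
have := nmD (q.2 - (u n).2) ((u n).2 - p.2).
by rewrite !subrKA; split; lra.
Qed.

Lemma pair_closure_linear :
  (forall (k : R[i]) x y, S x -> S y -> S (k *: x + y)) ->
  forall (k : R[i]) x y, pair_closure x -> pair_closure y -> pair_closure (k *: x + y).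
Proof.
move=> Slin k x y /pair_closureP[u [Su u1 u2]] /pair_closureP[t [St t1 t2]].
apply/pair_closureP; exists (fun n => k *: u n + t n); split.
- by move=> n; exact: Slin.
- by apply: cvgD t1; exact: cvgZl_tmp u1.
- by apply: cvgD t2; exact: cvgZl_tmp u2.
Qed.

(** Meant for [f = pi a] and [g = rho a]: the closure of [T] still intertwines the two
    representations, whence the invariance of the domain of [W]. *)
Lemma pair_closure_stable (f : H -> H) (g : K -> K) :
  bounded_operator f -> bounded_operator g ->
  (forall p, S p -> S (f p.1, g p.2)) ->
  forall p, pair_closure p -> pair_closure (f p.1, g p.2).
Proof.
move=> bf bg Sfg p /pair_closureP[u [Su u1 u2]]; apply/pair_closureP.
exists (fun n => (f (u n).1, g (u n).2)); split=> [n||]; first exact: Sfg.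
- exact: bounded_cvg bf u1.
- exact: bounded_cvg bg u2.
Qed.

End PairClosure.

(** * Absolute continuity as closability *)

Section GNS.
Context {R : realType} {A : starAlgType R}.
Implicit Types (v w : {scalar A}) (a b : A).

Lemma starB a b : star a - star b = star (a - b).
Proof.
rewrite (_ : a - b = -1 *: b + a); last by rewrite scaleN1r addrC.
by rewrite star_semilinear rmorphN1 scaleN1r addrC.
Qed.

Lemma gns_inner v (H : hilbertType R) (pi : A -> H -> H) (zeta : H) a b :
  gns_triple v pi zeta -> v (star b ** a) = inner (pi a zeta) (pi b zeta).
Proof.
move=> [[_ _ piM piS] _ ->].
by rewrite piM piS starK.
Qed.

Lemma cvg_real_complex0 (T : Type) (F : set_system T) (FF : Filter F) (r : T -> R) :
  (forall t, 0 <= r t) ->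
  ((r t)%:C @[t --> F] --> (0 : R[i]^o)) <-> (r t @[t --> F] --> (0 : R)).
Proof.
move=> r0; have rC t : `|0 - (r t)%:C| = (`|0 - r t|)%:C.
  by rewrite !sub0r !normrN ger0_norm ?ler0c// ger0_norm.
have E := @cvgrPdist_lt (R[i] : numFieldType) (R[i]^o : normedModType R[i]) T F FF
  (fun t => (r t)%:C) 0.
split=> [/E.1 h|/cvgrPdist_lt h].
  apply/cvgrPdist_lt => e e0; have e0' : 0 < e%:C :> R[i] by rewrite ltr0c.
  by apply: filterS (h _ e0') => t; rewrite rC ltcR.
apply/E.2 => _ /gtc0_real[c c0 ->]; apply: filterS (h _ c0) => t.
by rewrite rC ltcR.
Qed.

Lemma near_oo_pair (P : nat * nat -> Prop) :
  (\forall nm \near (\oo, \oo), P nm) <->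
  exists N, forall m n, (N <= m)%N -> (N <= n)%N -> P (m, n).
Proof.
split=> [[[Q1 Q2]/= [[N1 _ h1] [N2 _ h2]] QP]|[N NP]].
  exists (maxn N1 N2) => m n; rewrite !geq_max => /andP[m1 _] /andP[_ n2].
  by apply: QP; split; [exact: h1|exact: h2].
exists ([set m | (N <= m)%N], [set n | (N <= n)%N]); first by split; exists N.
by move=> [m n] [/= Nm Nn]; exact: NP.
Qed.

(** In the GNS spaces [v] and [w] of [star a ** a] are the squared norms of [pi a zeta] and
    [rho a xi], so the conditions on the functionals become norm convergence and the Cauchy
    property. *)
Lemma absolutely_continuousP v w (H K : hilbertType R)
    (pi : A -> H -> H) (zeta : H) (rho : A -> K -> K) (xi : K) :
  gns_triple v pi zeta -> gns_triple w rho xi ->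
  absolutely_continuous w v <->
  forall a : nat -> A, pi (a n) zeta @[n --> \oo] --> (0 : H) ->
    (forall e : R, 0 < e -> exists N, forall m n, (N <= m)%N -> (N <= n)%N ->
      nm (rho (a m) xi - rho (a n) xi) < e) ->
    rho (a n) xi @[n --> \oo] --> (0 : K).
Proof.
move=> gv gw.
have sq (f : nat -> R) (f0 : forall n, 0 <= f n) :
    f n ^+ 2 @[n --> \oo] --> (0 : R) <-> f @ \oo --> (0 : R).
  split=> [|h]; first exact: cvg_sqr_le.
  by rewrite -(mulr0 0); apply: cvgM.
have E1 (B : hilbertType R) (u : {scalar A}) (tau : A -> B -> B) (x : B) (a : nat -> A) :
    gns_triple u tau x ->
    (u (star (a n) ** a n) @[n --> \oo] --> (0 : R[i]^o)) <->
    (tau (a n) x @[n --> \oo] --> (0 : B)).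
  move=> g; under eq_fun do rewrite (gns_inner _ _ g) nm_sqrE.
  rewrite cvg_real_complex0; last by move=> n; rewrite sqr_ge0.
  rewrite sq; last by move=> n; exact: nm_ge0.
  rewrite (_ : (fun n => nm (tau (a n) x)) = (fun n => nm (tau (a n) x - 0))).
    by split=> /cvg_nm0.
  by apply/funext => n; rewrite subr0.
have E2 (a : nat -> A) :
    (w ((star (a nm.1) - star (a nm.2)) ** (a nm.1 - a nm.2)) @[nm --> (\oo, \oo)]
      --> (0 : R[i]^o)) <->
    forall e : R, 0 < e -> exists N, forall m n, (N <= m)%N -> (N <= n)%N ->
      nm (rho (a m) xi - rho (a n) xi) < e.
  have [[_ rl _ _] _ _] := gw.
  have wE p : w ((star (a p.1) - star (a p.2)) ** (a p.1 - a p.2)) =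
      (nm (rho (a p.1) xi - rho (a p.2) xi) ^+ 2)%:C.
    rewrite starB (gns_inner _ _ gw) nm_sqrE.
    by rewrite addrC -scaleN1r rl scaleN1r [X in nm X]addrC.
  under eq_fun do rewrite wE.
  rewrite cvg_real_complex0; last by move=> n; rewrite sqr_ge0.
  split=> [/cvgrPdist_lt h e e0|h].
    have /near_oo_pair[N NP] := h _ (exprn_gt0 2 e0).
    exists N => m n Nm Nn; have := NP m n Nm Nn.
    rewrite /= sub0r normrN ger0_norm ?sqr_ge0// ltr_pXn2r// ?nnegrE ?nm_ge0//.
    exact: ltW.
  apply/cvgrPdist_lt => e e0; have [|N NP] := h (Num.sqrt e); first by rewrite sqrtr_gt0.
  apply/near_oo_pair; exists N => m n Nm Nn /=.
  rewrite sub0r normrN ger0_norm ?sqr_ge0// -[ltRHS]sqr_sqrtr ?ltW//.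
  by rewrite ltr_pXn2r// ?nnegrE ?nm_ge0 ?sqrtr_ge0//; exact: NP.
split=> h a /(E1 _ _ _ _ _ gv) h1 /E2 h2; apply/(E1 _ _ _ _ _ gw); exact: h.
Qed.

End GNS.

(** * From absolute continuity to the operator, and back *)

Theorem theorem5p3 (R : realType) (A : starAlgType R) (v w : {scalar A})
    (hv : representable v) (hw : representable w)
    (H : hilbertType R) (pi : A -> H -> H) (zeta : H)
    (hH : gns_triple v pi zeta) :
  absolutely_continuous w v <->
  exists W : operator H,
    [/\ positive_operator W /\ selfadjoint W,
        range (fun a => pi a zeta) `<=` op_dom W,
        forall a b : A, w (star b ** a) = inner (W (pi a zeta)) (W (pi b zeta)),
        forall (a : A) (xi : H), op_dom W xi -> op_dom W (pi a xi) &
        forall (a : A) (xi eta : H), op_dom W xi -> op_dom W eta ->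
          inner (W (pi a xi)) (W eta) = inner (W xi) (W (pi (star a) eta))].
Proof.
have [_ [K [rho [xi hK]]]] := hw.
have [[bpi lpi Mpi Spi] Dpi _] := hH; have [[brho lrho Mrho Srho] _ _] := hK.
rewrite (absolutely_continuousP hH hK); split=> [ac|].
  (* The graph of [T]; [modulus] is applied to its closure. *)
  pose S := range (fun a => (pi a zeta, rho a xi)).
  have Slin (k : R[i]) x y : S x -> S y -> S (k *: x + y).
    by move=> [a _ <-] [b _ <-]; exists (k *: a + b) => //; rewrite lpi lrho.
  have S0 : S 0.
    have [p Sp] : S !=set0 by exists (pi 0 zeta, rho 0 xi), 0.
    by have := Slin (-1) _ _ Sp Sp; rewrite scaleN1r addNr.
  have G0 := sub_pair_closure S0.
  (* Absolute continuity enters here: a sequence in [S] tending to [(0, y)] has Cauchy second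
     components, which must tend to 0. *)
  have Gfun y : pair_closure S (0, y) -> y = 0.
    move=> /pair_closureP[u [Su u1 u2]].
    have /choice[a aP] n : exists a, (pi a zeta, rho a xi) = u n.
      by have [a _] := Su n; exists a.
    rewrite -(funext (fun n => congr1 fst (aP n))) in u1.
    rewrite -(funext (fun n => congr1 snd (aP n))) in u2.
    exact: cvg_uniq u2 (ac a u1 (nm_cauchy u2)).
  have Gdense : dense [set x | exists y, pair_closure S (x, y)].
    apply: dense_sub Dpi => _ [a _ <-]; exists (rho a xi).
    by apply: sub_pair_closure; exists a.
  have [W [posW domW WE]] := modulus G0 (pair_closure_linear Slin)
    (@pair_closure_closed _ _ _ S) Gfun Gdense.
  have SG a : pair_closure S (pi a zeta, rho a xi).
    by apply: sub_pair_closure; exists a.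
  have stable a x y : pair_closure S (x, y) -> pair_closure S (pi a x, rho a y).
    apply: (@pair_closure_stable _ _ _ S (pi a) (rho a)) => // _ [b _ <-].
    by exists (a ** b) => //=; rewrite Mpi Mrho.
  exists W; split => //.
  - by move=> _ [a _ <-]; apply/domW; exists (rho a xi).
  - by move=> a b; rewrite (gns_inner _ _ hK); apply/esym/WE.
  - by move=> a x /domW[y Gxy]; apply/domW; exists (rho a y); exact: stable.
  (* Both sides are inner products in [K], where the identity is the adjoint relation between
     [rho a] and [rho (star a)]. *)
  - move=> a x x' /domW[y Gxy] /domW[y' Gxy'].
    by rewrite (WE _ _ _ _ (stable a _ _ Gxy) Gxy') Srho (WE _ _ _ _ Gxy (stable _ _ _ Gxy')).
move=> [W [[_ [dW saW]] domW wW _ _]] a a0 ca.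
have dpi b : op_dom W (pi b zeta) by apply: domW; exists b.
have WB b c : W (pi (b - c) zeta) = W (pi b zeta) - W (pi c zeta).
  have -> : pi (b - c) zeta = -1 *: pi c zeta + pi b zeta by rewrite -lpi scaleN1r addrC.
  by rewrite op_linear// scaleN1r addrC.
(* This isometry turns the Cauchy hypothesis into one on [W (pi (a n) zeta)]. *)
have nmW b : nm (W (pi b zeta)) = nm (rho b xi).
  apply/eqP; rewrite -(@eqrXn2 _ 2)// ?nm_ge0//; apply/eqP/complexI.
  by rewrite -!nm_sqrE -wW (gns_inner _ _ hK).
have rhoB b c : rho (b - c) xi = rho b xi - rho c xi.
  by have := lrho (-1) c b xi; rewrite !scaleN1r ![- _ + _]addrC.
have [e e0|y Wy] := @nm_complete _ _ (fun n => W (pi (a n) zeta)).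
  have [N NP] := ca e e0; exists N => m n Nm Nn.
  by rewrite -WB nmW rhoB; exact: NP.
(* For [x] in the dense domain, [<y, x>] is the limit of [<pi (a n) zeta, W x>], which is 0. *)
have y0 : y = 0.
  apply: (dense_orthogonal dW) => x dx.
  have h1 := rip_cvg (y := x) Wy; have h2 := rip_cvg (y := W x) a0.
  rewrite (_ : (fun n => rip (W (pi (a n) zeta)) x) =
               (fun n => rip (pi (a n) zeta) (W x))) in h1.
    by rewrite ripC (cvg_unique _ h1 h2)// rip0l.
  apply/funext => n; rewrite /rip.
  have [_ /(_ (conj dx erefl)) adj] := saW x (W x).
  by rewrite adj.
rewrite y0 in Wy; apply/cvg_nm0; move/cvg_nm0 : Wy.
by under eq_fun do rewrite subr0 nmW; under [in X in _ -> X]eq_fun do rewrite subr0.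
Qed.
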